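(* Let $\mu>0$ be a real number, let $Y\sim \mathrm{Poi}(\mu)$, and let $k$ be a positive integer such that $k\ge\mu$. Then \[ \mathbb{E}\left[Y\mid Y\ge k\right] \le k+\frac{\mu}{k+1-\mu}. \] Furthermore, if we set $\ell=\lfloor k-\mu\rfloor$, then \[ \mathbb{P}\left[Y\ge k\right] \ge \frac{1}{2}\cdot\left(\frac{\mu}{k+\mu}\right)^{\ell+1}. \]
   Context: $\mathrm{Poi}(\mu)$ denotes a Poisson random variable of mean $\mu$, and $Y\sim\mathrm{Poi}(\mu)$ means that $Y$ has this distribution. $\mathbb{E}[Y\mid Y\ge k]=\sum_{i\ge k} i\,\mathbb{P}[Y=i]/\mathbb{P}[Y\ge k]$ is the tail conditional expectation. $\lfloor x\rfloor$ is the largest integer less than or equal to $x$. *)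

(* Defs.v *)
From mathcomp Require Import all_boot all_order all_algebra.
From mathcomp Require Import all_classical all_reals all_analysis.

Set Implicit Arguments.
Unset Strict Implicit.
Unset Printing Implicit Defensive.

Import Order.TTheory GRing.Theory Num.Theory.

Local Open Scope classical_set_scope.
Local Open Scope ring_scope.
Local Open Scope ereal_scope.

(* [poisson_prob] takes a second, natural-number argument that it ignores. *)
Definition Poi_distributed (R : realType) (mu : R) (d : measure_display)
    (T : measurableType d) (P : probability T R) (Y : {RV P >-> nat}) : Prop :=
  distribution P Y = poisson_prob mu 0%N :> (set nat -> \bar R).

(* E[Y | Y >= k]; meaningful when P[Y >= k] > 0. *)
Definition tail_expectation (R : realType) (d : measure_display)
    (T : measurableType d) (P : probability T R) (Y : {RV P >-> nat})
    (k : nat) : \bar R :=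
  (\sum_(k <= i <oo) i%:R%:E * P [set w | Y w = i]) / P [set w | (k <= Y w)%N].

(* Main.v *)
Require Import Defs.
From mathcomp Require Import all_boot all_order all_algebra.
From mathcomp Require Import all_classical all_reals all_analysis.
From mathcomp Require Import zify ring lra.

(** Write [p i] for the probabilities and [T n = P[Y >= n]].  For [i > k],
[(k + 1) p i <= i p i = mu p (i - 1)]; weighting by [i - k] and summing gives
[(k + 1) S <= mu (S + T k)] for [S = E[Y - k; Y >= k]], which is the first
bound.  For the second one, [(n + 1) T (n + 1) >= (n + 1) p (n + 1) = mu p n]
gives [T (n + 1) / T n >= mu / (n + 1 + mu)].  Starting from
[m = k - l - 1 < mu], the [l + 1] ratios up to [k] are all at least
[mu / (k + mu)], and [T m >= 1 / 2] because [p (m - 1 - j) <= p (m + j)]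
whenever [j < m <= mu]. *)

Import Order.TTheory GRing.Theory Num.Theory.

Local Open Scope classical_set_scope.
Local Open Scope ring_scope.

(** The probability of being at least [n], taken through the complement so that it is a finite real
    sum rather than an infinite series. *)
Definition poisson_tail {R : realType} (mu : R) (n : nat) : R :=
  1 - \sum_(i < n) poisson_pmf mu i.

Lemma poisson_pmfS {R : realType} (mu : R) (n : nat) :
  0 < mu -> n.+1%:R * poisson_pmf mu n.+1 = mu * poisson_pmf mu n.
Proof.
move=> mu0; rewrite /poisson_pmf mu0 factS exprS natrM.
have n0 : n.+1%:R != 0 :> R by rewrite pnatr_eq0.
have f0 : n`!%:R != 0 :> R by rewrite pnatr_eq0 -lt0n fact_gt0.
by field; rewrite f0 nat1r n0.
Qed.

Lemma poisson_pmf_gt0 {R : realType} (mu : R) (n : nat) :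
  0 < mu -> 0 < poisson_pmf mu n.
Proof.
move=> mu0; rewrite /poisson_pmf mu0.
by rewrite !mulr_gt0 ?exprn_gt0 ?expR_gt0// invr_gt0 ltr0n fact_gt0.
Qed.

Lemma poisson_prob_set1 {R : realType} (mu : R) (n i : nat) :
  0 < mu -> poisson_prob mu n [set i] = (poisson_pmf mu i)%:E.
Proof.
by move=> mu0; rewrite /poisson_prob mu0 esum_set1// lee_fin poisson_pmf_ge0.
Qed.

Lemma poisson_prob_geq {R : realType} (mu : R) (i n : nat) :
  0 < mu -> poisson_prob mu i [set j | (n <= j)%N] = (poisson_tail mu n)%:E.
Proof.
move=> mu0.
have -> : [set j | (n <= j)%N] = ~` `I_n.
  by apply/seteqP; split => j /=; case: leqP.
rewrite (probability_setC (poisson_prob mu i))// /poisson_tail EFinB.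
congr (_ - _)%E; rewrite /= /poisson_prob mu0 esum_fset//.
  by rewrite -fsbig_ord sumEFin.
by move=> j _; rewrite lee_fin poisson_pmf_ge0.
Qed.

Lemma poisson_tail_ge0 {R : realType} (mu : R) (n : nat) :
  0 < mu -> 0 <= poisson_tail mu n.
Proof. by move=> mu0; rewrite -lee_fin -(poisson_prob_geq mu 0). Qed.

Lemma poisson_tailS {R : realType} (mu : R) (n : nat) :
  poisson_tail mu n.+1 = poisson_tail mu n - poisson_pmf mu n.
Proof. by rewrite /poisson_tail big_ord_recr /= opprD addrA. Qed.

Lemma poisson_tail_gt0 {R : realType} (mu : R) (n : nat) :
  0 < mu -> 0 < poisson_tail mu n.
Proof.
move=> mu0; have := poisson_tail_ge0 mu n.+1 mu0.
by have := poisson_pmf_gt0 mu n mu0; rewrite poisson_tailS; lra.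
Qed.

Lemma poisson_tail_ratio {R : realType} (mu : R) (n : nat) :
  0 < mu ->
  poisson_tail mu n * (mu / (n.+1%:R + mu)) <= poisson_tail mu n.+1.
Proof.
move=> mu0; have n0 : 0 < n.+1%:R :> R by rewrite ltr0n.
rewrite mulrA ler_pdivrMr; last by rewrite addr_gt0.
have ET := poisson_tailS mu n.
(* Nonnegativity of the tail at [n.+2] says that the tail at [n.+1] is at least
   [poisson_pmf mu n.+1]. *)
have le2 : 0 <= n.+1%:R * poisson_tail mu n.+2.
  by rewrite mulr_ge0 ?poisson_tail_ge0 // ltW.
move: le2; rewrite poisson_tailS mulrBr poisson_pmfS// ET; lra.
Qed.

(** Induction from the innermost pair outwards: moving both indices out by one reduces the claim to
    a bound on a product of two factors by [mu * mu]. *)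
Lemma poisson_pmf_reflect {R : realType} (mu : R) (j a : nat) :
  0 < mu -> (a + j.+1)%:R <= mu ->
  poisson_pmf mu a <= poisson_pmf mu (a + j.*2.+1).
Proof.
move=> mu0; elim: j a => [|j IH] a le_mu.
  have p0 := poisson_pmf_gt0 mu a mu0; rewrite addn1 in le_mu *.
  by rewrite -(ler_pM2l mu0) -poisson_pmfS// ler_pM2r// poisson_pmf_gt0.
have := IH a.+1; rewrite addSnnS => /(_ le_mu).
set b := (a.+1 + j.*2.+1)%N => le_ab.
have -> : (a + j.+1.*2.+1 = b.+1)%N by rewrite /b; lia.
have a0 : 0 < a.+1%:R :> R by rewrite ltr0n.
have b0 : 0 < b.+1%:R :> R by rewrite ltr0n.
rewrite -(ler_pM2l mu0) -(ler_pM2l mu0) -(poisson_pmfS mu a)//.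
have -> : mu * (a.+1%:R * poisson_pmf mu a.+1) =
          a.+1%:R * (mu * poisson_pmf mu a.+1) by ring.
apply: (@le_trans _ _ (a.+1%:R * (mu * poisson_pmf mu b))).
  by rewrite !ler_pM2l.
rewrite -poisson_pmfS// !mulrA ler_pM2r ?poisson_pmf_gt0//.
(* AM-GM: [a.+1] and [b.+1] have mean [a + j.+2], which is at most [mu]. *)
apply: (@le_trans _ _ ((a + j.+2)%:R * (a + j.+2)%:R)).
  rewrite -!natrM ler_nat /b -addnn; nia.
by apply: ler_pM.
Qed.

Lemma poisson_tail_ge_half {R : realType} (mu : R) (n : nat) :
  0 < mu -> n%:R <= mu -> 1 / 2 <= poisson_tail mu n.
Proof.
move=> mu0 le_mu; have := poisson_tail_ge0 mu (n + n) mu0.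
rewrite /poisson_tail big_split_ord /=.
suff : \sum_(i < n) poisson_pmf mu i <= \sum_(i < n) poisson_pmf mu (n + i).
  lra.
(* Reversing the lower half pairs [n - i.+1] with [n + i], at the odd distance [i.*2.+1]. *)
rewrite (reindex_inj rev_ord_inj) /=; apply: ler_sum => i _.
have lt_in := ltn_ord i.
have -> : (n + i = n - i.+1 + i.*2.+1)%N by rewrite -addnn; lia.
by apply: poisson_pmf_reflect; rewrite ?subnK.
Qed.

Lemma poisson_tail_lower {R : realType} (mu : R) (m j : nat) :
  0 < mu -> m%:R <= mu ->
  1 / 2 * (mu / ((m + j)%:R + mu)) ^+ j <= poisson_tail mu (m + j).
Proof.
move=> mu0 le_mu; set r := mu / _.
have r0 : 0 <= r by rewrite divr_ge0 ?addr_ge0 // ltW.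
(* The ratio [r] stays fixed at its value for the last index [m + j], the smallest of all, while [i]
   varies. *)
have H i : (i <= j)%N -> 1 / 2 * r ^+ i <= poisson_tail mu (m + i).
  elim: i => [|i IH] lt_ij.
    by rewrite expr0 mulr1 addn0 poisson_tail_ge_half.
  rewrite addnS; apply: le_trans (poisson_tail_ratio mu _ mu0).
  rewrite exprSr [leLHS]mulrA; apply: ler_pM => //.
  - by rewrite mulr_ge0 ?exprn_ge0// divr_ge0.
  - exact/IH/ltnW.
  - rewrite /r ler_pM2l// lef_pV2 ?posrE ?ltr_wpDl ?ler0n//.
    by rewrite lerD2r ler_nat; lia.
exact: H.
Qed.

(** Truncated form of the recursion for the excess over [k]. The left sum runs one term further
    because its term at [i] is compared with [poisson_pmf mu i.-1]. *)
Lemma poisson_excess_rec {R : realType} (mu : R) (k n : nat) :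
  0 < mu ->
  k.+1%:R * \sum_(k <= i < k + n.+1) (i - k)%:R * poisson_pmf mu i <=
  mu * (\sum_(k <= i < k + n) (i - k)%:R * poisson_pmf mu i +
        \sum_(k <= i < k + n) poisson_pmf mu i).
Proof.
move=> mu0; elim: n => [|n IH].
  by rewrite addn0 addn1 big_nat1 subnn mul0r !big_geq// mulr0 addr0 mulr0.
have recr m (F : nat -> R) :
    \sum_(k <= i < k + m.+1) F i = \sum_(k <= i < k + m) F i + F (k + m)%N.
  by rewrite addnS big_nat_recr ?leq_addr.
rewrite [X in _ * X <= _]recr [X in _ <= mu * (X + _)]recr.
rewrite [X in _ <= mu * (_ + X)]recr.
have -> : (k + n.+1 - k = n.+1)%N by lia.
have -> : (k + n - k = n)%N by lia.
have p0 : 0 < poisson_pmf mu (k + n.+1) by exact: poisson_pmf_gt0.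
have : k.+1%:R * (n.+1%:R * poisson_pmf mu (k + n.+1)) <=
       n.+1%:R * (mu * poisson_pmf mu (k + n)).
  rewrite -poisson_pmfS// -addnS mulrCA ler_pM2l ?ltr0n//.
  by rewrite ler_pM2r// ler_nat; lia.
by rewrite -[n.+1%:R]natr1; lra.
Qed.

Lemma poisson_partial_mean {R : realType} (mu : R) (k N : nat) :
  0 < mu -> mu <= k%:R ->
  \sum_(k <= i < N) i%:R * poisson_pmf mu i <=
  (k%:R + mu / (k%:R + 1 - mu)) * poisson_tail mu k.
Proof.
move=> mu0 le_k.
have d0 : 0 < k%:R + 1 - mu by lra.
have T0 := poisson_tail_gt0 mu k mu0.
case: (leqP N k) => [le_Nk|lt_kN].
  rewrite big_geq// mulr_ge0 ?(ltW T0)// addr_ge0 ?ler0n//.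
  by rewrite divr_ge0// ltW.
have -> : N = (k + (N - k.+1).+1)%N by lia.
move: (N - k.+1)%N => n {N lt_kN}.
have leT m : \sum_(k <= i < k + m) poisson_pmf mu i <= poisson_tail mu k.
  have := poisson_tail_ge0 mu (k + m) mu0.
  rewrite /poisson_tail -!(big_mkord xpredT (fun i => poisson_pmf mu i)).
  by rewrite (big_cat_nat (n := k)) ?leq_addr//=; lra.
have -> : \sum_(k <= i < k + n.+1) i%:R * poisson_pmf mu i =
    k%:R * \sum_(k <= i < k + n.+1) poisson_pmf mu i +
    \sum_(k <= i < k + n.+1) (i - k)%:R * poisson_pmf mu i.
  rewrite big_distrr -big_split /=; apply: eq_big_nat => i /andP[le_ki _].
  by rewrite natrB//; ring.
have := poisson_excess_rec mu k n mu0.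
set A := \sum_(k <= i < k + n.+1) (i - k)%:R * _.
have : \sum_(k <= i < k + n) (i - k)%:R * poisson_pmf mu i <= A.
  rewrite /A addnS big_nat_recr ?leq_addr//= lerDl.
  by rewrite mulr_ge0// poisson_pmf_ge0.
set B := \sum_(k <= i < k + n) _ => le_BA le_A.
have le_kT := ler_wpM2l (ler0n R k) (leT n.+1).
suff : A <= mu / (k%:R + 1 - mu) * poisson_tail mu k by lra.
(* Since the shorter excess sum is at most [A], the recursion gives [k.+1%:R * A <= mu * (A +
   poisson_tail mu k)], to be solved for [A]. *)
rewrite mulrAC ler_pdivlMr//.
have := ler_wpM2l (ltW mu0) (lerD le_BA (leT n)).
by move: le_A; rewrite -natr1; lra.
Qed.

Theorem theorem1p2 (R : realType) (d : measure_display) (T : measurableType d)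
    (P : probability T R) (mu : R) (Y : {RV P >-> nat}) (k : nat) :
  0 < mu -> Poi_distributed mu Y -> (0 < k)%N -> mu <= k%:R ->
  (tail_expectation Y k <= (k%:R + mu / (k%:R + 1 - mu))%:E)%E /\
  (let l : int := Num.floor (k%:R - mu) in
   ((1 / 2 * (mu / (k%:R + mu)) ^ (l + 1))%:E <= P [set w | (k <= Y w)%N])%E).
Proof.
move=> mu0 PoiY k0 le_k.
have PE A : P (Y @^-1` A) = poisson_prob mu 0 A by rewrite -PoiY.
have PT : P [set w | (k <= Y w)%N] = (poisson_tail mu k)%:E.
  by rewrite -(poisson_prob_geq mu 0)// -PE.
have P1 i : P [set w | Y w = i] = (poisson_pmf mu i)%:E.
  by rewrite -(poisson_prob_set1 mu 0)// -PE.
have T0 := poisson_tail_gt0 mu k mu0.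
split.
  rewrite /tail_expectation PT inver gt_eqF// lee_pdivrMr// -EFinM.
  apply: lime_le.
    by apply: is_cvg_ereal_nneg_natsum => n _; rewrite mule_ge0// lee_fin.
  (* The bound holds for every partial sum, hence for the limit. *)
  apply: nearW => N.
  under eq_bigr do rewrite P1 -EFinM.
  by rewrite sumEFin lee_fin poisson_partial_mean.
rewrite /= PT lee_fin.
have := floor_itv (k%:R - mu).
have : 0 <= Num.floor (k%:R - mu) by rewrite floor_ge0 subr_ge0.
case: (Num.floor _) => // a _ /andP[le_a lt_a].
(* As [mu] is positive, [a <= k - mu < k], so the starting index [k - a.+1] is not truncated;
   [k - mu < a + 1] then puts it below [mu]. *)
have lt_ak : (a < k)%N.
  by rewrite -(ltr_nat R); move: le_a; rewrite -pmulrn; lra.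
have Ek : k = (k - a.+1 + a.+1)%N by rewrite subnK.
have -> : (a : int) + 1 = a.+1 :> int by rewrite -addn1 PoszD.
rewrite -exprnP {1 2}Ek; apply: poisson_tail_lower => //.
rewrite natrB//; move: lt_a; rewrite -[_ + 1]/(Posz (a + 1)) addn1 -pmulrn; lra.
Qed.
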